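(* Let $A, B$ be $n\times n$ positive definite complex matrices. The following are equivalent: (1) $A\preceq B$; (2) $A\diamond_t B\preceq A\diamond_s B$ for certain (i.e. there exist) real $t,s$ with $0\le t<s\le 1$; (3) $A\natural_t B\preceq A\natural_s B$ for certain (i.e. there exist) real $t,s$ with $t<s$. Moreover, when $A\preceq B$, the parametric curves $\{A\diamond_t B\mid t\ge 0\}$ and $\{A\natural_t B\mid t\in\mathbb R\}$ are monotonically increasing with respect to the near order, that is, for real $t,s$: $$0\le t<s\ \Longrightarrow\ A\diamond_t B\preceq A\diamond_s B,\qquad t<s\ \Longrightarrow\ A\natural_t B\preceq A\natural_s B.$$
   Context: Positive definite means Hermitian positive definite. For positive definite $A,B$: $A\sharp B = A^{1/2}(A^{-1/2}BA^{-1/2})^{1/2}A^{1/2}$. For all $t\in\mathbb R$, $X\nabla_t Y=(1-t)X+tY$. The spectral geometric mean (extended to all $t\in\mathbb R$) is $A\natural_t B=(A^{-1}\sharp B)^tA(A^{-1}\sharp B)^t$. The Wasserstein mean (extended to all $t\in\mathbb R$) is $A\diamond_t B=(1-t)^2A+t^2B+t(1-t)[(AB)^{1/2}+(BA)^{1/2}]$, where the square roots are those with positive eigenvalues; equivalently $A\diamond_tB=[I\nabla_t(A^{-1}\sharp B)]A[I\nabla_t(A^{-1}\sharp B)]$. The near order $A\preceq B$ on positive definite matrices means $A^{-1}\sharp B\ge I$, where $\ge$ is the Löwner order. *)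

(* Defs.v *)
From HB Require Import structures.
From mathcomp Require Import all_boot all_order all_algebra.
From mathcomp Require Import boolp classical_sets reals exp.
From mathcomp Require Import complex.

Set Implicit Arguments.
Unset Strict Implicit.
Unset Printing Implicit Defensive.

Import Order.TTheory GRing.Theory Num.Theory.

Local Open Scope ring_scope.
Local Open Scope complex_scope.
Local Open Scope sesquilinear_scope.

Section MatrixMeans.
Variables (R : realType) (n : nat).
Implicit Types (A B M X Y S : 'M[R[i]]_n) (t : R).

(* In the order of R[i], [0 < z] means that z is real and positive. *)
Definition posdefmx M : Prop :=
  M \is hermsymmx /\
  forall x : 'cV[R[i]]_n, x != 0 -> 0 < (x^t* *m M *m x) 0 0.

Definition possemidefmx M : Prop :=
  M \is hermsymmx /\
  forall x : 'cV[R[i]]_n, 0 <= (x^t* *m M *m x) 0 0.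

Definition loewner_le X Y : Prop := possemidefmx (Y - X).

(* M^t, computed on the eigenvalues in the unitary diagonalization
   M = P^-1 D P given by [spectralmx] and [spectral_diag]; meaningful for
   positive definite M, whose eigenvalues are real and positive. *)
Definition powRmx M t : 'M[R[i]]_n :=
  invmx (spectralmx M)
    *m diag_mx (\row_j (complex.Re (spectral_diag M 0 j) `^ t)%:C)
    *m spectralmx M.

(* The square root of M with positive eigenvalues (0 if there is none); M need
   not be Hermitian.  When M = A B with A, B positive definite, it exists and
   is unique. *)
Definition possqrtmx M : 'M[R[i]]_n :=
  xget 0 [set S | S *m S = M /\
                  forall a : R[i], eigenvalue S a -> 0 < a]%classic.

Definition wmeanmx t X Y : 'M[R[i]]_n := (1 - t)%:C *: X + t%:C *: Y.

Definition gmeanmx A B : 'M[R[i]]_n :=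
  powRmx A 2^-1
    *m powRmx (powRmx A (- 2^-1) *m B *m powRmx A (- 2^-1)) 2^-1
    *m powRmx A 2^-1.

Definition spectral_mean t A B : 'M[R[i]]_n :=
  let X := gmeanmx (invmx A) B in powRmx X t *m A *m powRmx X t.

Definition wasserstein_mean t A B : 'M[R[i]]_n :=
  ((1 - t) ^+ 2)%:C *: A + (t ^+ 2)%:C *: B
  + (t * (1 - t))%:C *: (possqrtmx (A *m B) + possqrtmx (B *m A)).

(* A relation between positive definite matrices: positive definiteness of both
   sides is part of it. *)
Definition near_le A B : Prop :=
  [/\ posdefmx A, posdefmx B & loewner_le 1%:M (gmeanmx (invmx A) B)].

End MatrixMeans.

(* Main.v *)
(** For positive definite A, B, the matrix X = A^-1 # B is the only positive
    definite solution of the Riccati equation X A X = B.  Hence, for positive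
    definite C and G, C is below G C G in the near order iff G >= I.  Both means
    have the form Y_t A Y_t with Y_t a function of X: Y_t = X^t for the spectral
    mean, and Y_t = (1-t) I + t X for the Wasserstein mean because A B = (A X)^2
    and B A = (X A)^2.  So the points at s and t are related by the function
    G = Y_s Y_t^-1 of X, and G >= I iff every eigenvalue of X is at least 1,
    that is, iff A is below B. *)

Require Import Defs.
From mathcomp Require Import all_boot all_order all_algebra.
From mathcomp Require Import boolp classical_sets.
From mathcomp Require Import reals exp complex.
From mathcomp Require Import ring lra.

Set Implicit Arguments.
Unset Strict Implicit.
Unset Printing Implicit Defensive.

Import Order.TTheory GRing.Theory Num.Theory.

Local Open Scope ring_scope.
Local Open Scope complex_scope.
Local Open Scope sesquilinear_scope.

(** * Adjoints, diagonalized matrices and uniqueness of positive square roots *)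

Section Adjoint.
Variable C : numClosedFieldType.

Lemma adjmxM m n p (A : 'M[C]_(m, n)) (B : 'M[C]_(n, p)) :
  (A *m B)^t* = B^t* *m A^t*.
Proof. by rewrite trmx_mul map_mxM. Qed.

Lemma hermsymmxP n (A : 'M[C]_n) : reflect (A^t* = A) (A \is hermsymmx).
Proof.
by apply: (iffP (is_hermitianmxP _ _ _)); rewrite expr0 scale1r => /esym.
Qed.

Lemma hermsymmx_congr n (A P : 'M[C]_n) :
  A \is hermsymmx -> P^t* *m A *m P \is hermsymmx.
Proof.
by move=> /hermsymmxP hA; apply/hermsymmxP; rewrite !adjmxM hA trmxCK mulmxA.
Qed.

Lemma row_mul_diag m n (d : 'rV[C]_m) (A : 'M[C]_(m, n)) i :
  row i (diag_mx d *m A) = d 0 i *: row i A.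
Proof. by rewrite mul_diag_mx; apply/rowP=> j; rewrite !mxE. Qed.

(** [U] may be non-unitary: products [A *m X] of positive definite matrices are diagonalizable but
    in general not normal. *)
Definition conj_diag n (U : 'M[C]_n) (d : 'rV[C]_n) : 'M[C]_n :=
  invmx U *m diag_mx d *m U.

Lemma conj_diagM n (U : 'M[C]_n) (d e : 'rV[C]_n) : U \in unitmx ->
  conj_diag U d *m conj_diag U e = conj_diag U (\row_j (d 0 j * e 0 j)).
Proof.
by move=> uU; rewrite /conj_diag -mulmx_diag !mulmxA mulmxK.
Qed.

Lemma conj_diagD n (U : 'M[C]_n) (d e : 'rV[C]_n) :
  conj_diag U d + conj_diag U e = conj_diag U (d + e).
Proof. by rewrite /conj_diag raddfD mulmxDr mulmxDl. Qed.

Lemma conj_diagZ n (U : 'M[C]_n) c (d : 'rV[C]_n) :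
  c *: conj_diag U d = conj_diag U (c *: d).
Proof. by rewrite /conj_diag linearZ -scalemxAr -scalemxAl. Qed.

Lemma conj_diag_const1 n (U : 'M[C]_n) : U \in unitmx ->
  conj_diag U (const_mx 1) = 1%:M.
Proof. by move=> uU; rewrite /conj_diag diag_const_mx mulmx1 mulVmx. Qed.

Lemma conj_diag_adj n (U : 'M[C]_n) (d : 'rV[C]_n) : U \is unitarymx ->
  (conj_diag U d)^t* = conj_diag U (map_mx Num.conj d).
Proof.
move=> hU; rewrite /conj_diag !adjmxM invmx_unitary // trmxCK mulmxA.
by rewrite tr_diag_mx map_diag_mx.
Qed.

Lemma conj_diag_form n (U : 'M[C]_n) (d : 'rV[C]_n) (x : 'cV[C]_n) :
    U \is unitarymx ->
  (x^t* *m conj_diag U d *m x) 0 0 = \sum_j d 0 j * `|(U *m x) j 0| ^+ 2.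
Proof.
move=> hU; rewrite /conj_diag invmx_unitary // !mulmxA -adjmxM.
rewrite -[_ *m U *m x]mulmxA; move: (U *m x) => y.
rewrite mul_mx_diag mxE; apply: eq_bigr => j _.
by rewrite !mxE normCK mulrAC [RHS]mulrC [y j 0 * _]mulrC.
Qed.

Lemma row_conj_diag n (U : 'M[C]_n) (d : 'rV[C]_n) i : U \in unitmx ->
  row i U *m conj_diag U d = d 0 i *: row i U.
Proof.
by move=> uU; rewrite /conj_diag -row_mul !mulmxA mulmxV // mul1mx row_mul_diag.
Qed.

Lemma eigenvalue_conj_diag n (U : 'M[C]_n) (d : 'rV[C]_n) i : U \in unitmx ->
  eigenvalue (conj_diag U d) (d 0 i).
Proof.
move=> uU; apply/eigenvalueP; exists (row i U); first exact: row_conj_diag.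
apply/eqP => v0; have := row_mul i U (invmx U).
rewrite v0 mul0mx mulmxV // row1 => /rowP/(_ i)/eqP.
by rewrite !mxE !eqxx oner_eq0.
Qed.

(* On an eigenvector v of T with eigenvalue d > 0 we have
   v (S - d) (S + d) = 0, and S + d is injective because -d is not a positive
   eigenvalue of S; hence S and T agree on an eigenbasis of T. *)
Lemma pos_sqrt_uniq n (S P : 'M[C]_n) (d : 'rV[C]_n) :
    let T := conj_diag P d in
    P \in unitmx -> (forall j, 0 < d 0 j) ->
    (forall a, eigenvalue S a -> 0 < a) -> S *m S = T *m T ->
  S = T.
Proof.
move=> T uP d_gt0 S_gt0 eqST.
suff: P *m S = P *m T by move/(congr1 (mulmx (invmx P))); rewrite !mulKmx.
apply/row_matrixP => i; rewrite !row_mul; set v := row i P.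
have vT : v *m T = d 0 i *: v by exact: row_conj_diag.
rewrite vT; apply/eqP; rewrite -subr_eq0; set w := _ - _.
have wS : w *m S = (- d 0 i) *: w.
  rewrite /w mulmxBl -mulmxA eqST mulmxA vT -!scalemxAl vT scalerBr !scaleNr.
  by rewrite opprK addrC.
apply: contraT => w_neq0; have /S_gt0 : eigenvalue S (- d 0 i).
  by apply/eigenvalueP; exists w.
by rewrite oppr_gt0 => /(lt_trans (d_gt0 i)); rewrite ltxx.
Qed.

End Adjoint.

(** * Positive definite matrices: congruences, inverses, eigenvalues *)

Section PositiveDefinite.
Variables (R : realType) (n : nat).
Implicit Types (A P X : 'M[R[i]]_n).

(** Eigenvectors and kernel vectors are rows in this development, whereas [posdefmx] tests columns;
    the adjoint of [v] links the two. *)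
Lemma posdefmx_row A (v : 'rV[R[i]]_n) :
  posdefmx A -> v != 0 -> 0 < (v *m A *m v^t*) 0 0.
Proof.
move=> [_ A_gt0] v_neq0; have := A_gt0 (v^t*); rewrite trmxCK; apply.
by apply: contra v_neq0 => /eqP v0; rewrite -[v]trmxCK v0 trmx0 map_mx0.
Qed.

Lemma posdefmx_unit A : posdefmx A -> A \in unitmx.
Proof.
move=> A_gt0; rewrite -row_free_unit -kermx_eq0; apply: contraT.
move=> /rowV0Pn[v /sub_kermxP vA v_neq0].
by have := posdefmx_row A_gt0 v_neq0; rewrite vA mul0mx mxE ltxx.
Qed.

Lemma posdefmx_adj A : posdefmx A -> A^t* = A.
Proof. by case=> /hermsymmxP. Qed.

Lemma posdefmx_congr A P :
  posdefmx A -> P \in unitmx -> posdefmx (P^t* *m A *m P).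
Proof.
move=> [hA A_gt0] uP; split=> [|x x_neq0]; first exact: hermsymmx_congr.
have -> : x^t* *m (P^t* *m A *m P) *m x = (P *m x)^t* *m A *m (P *m x).
  by rewrite adjmxM !mulmxA.
apply: A_gt0; apply: contra x_neq0 => /eqP Px0.
by rewrite -[x](mulKmx uP) Px0 mulmx0.
Qed.

Lemma posdefmx_congr_pos A P :
  posdefmx A -> posdefmx P -> posdefmx (P *m A *m P).
Proof.
move=> A_gt0 P_gt0; rewrite -{1}(posdefmx_adj P_gt0).
exact/posdefmx_congr/posdefmx_unit.
Qed.

Lemma posdefmx1 : posdefmx (1%:M : 'M[R[i]]_n).
Proof.
split=> [|x x_neq0]; first by apply/hermsymmxP; rewrite trmx1 map_mx1.
rewrite mulmx1 mxE; under eq_bigr do rewrite !mxE mulrC -normCK.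
rewrite lt0r sumr_ge0 ?andbT => [|i _]; last by rewrite exprn_ge0.
apply: contra x_neq0; rewrite psumr_eq0 => [/allP x0|i _]; last first.
  by rewrite exprn_ge0.
apply/eqP/matrixP=> i j; rewrite ord1 !mxE; apply/eqP.
by have := x0 i (mem_index_enum _); rewrite expf_eq0 normr_eq0.
Qed.

Lemma posdefmx_sqr A : posdefmx A -> posdefmx (A *m A).
Proof.
by move=> A_gt0; rewrite -{1}[A]mulmx1; apply: posdefmx_congr_pos posdefmx1 _.
Qed.

Lemma posdefmx_inv A : posdefmx A -> posdefmx (invmx A).
Proof.
move=> A_gt0; have uA := posdefmx_unit A_gt0.
have uV : invmx A \in unitmx by rewrite unitmx_inv.
have hV : (invmx A)^t* = invmx A by rewrite trmx_inv map_invmx posdefmx_adj.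
by have := posdefmx_congr A_gt0 uV; rewrite hV (mulVmx uA) mul1mx.
Qed.

Lemma eigenvalue_posdef_mul A X a :
  posdefmx A -> posdefmx X -> eigenvalue (A *m X) a -> 0 < a.
Proof.
move=> A_gt0 X_gt0 /eigenvalueP[v vAX v_neq0].
have vA_neq0 : v *m A != 0.
  apply: contra v_neq0 => /eqP vA0.
  by rewrite -[v](mulmxK (posdefmx_unit A_gt0)) vA0 mul0mx.
have := posdefmx_row X_gt0 vA_neq0.
rewrite adjmxM (posdefmx_adj A_gt0) -(mulmxA v A X) vAX.
rewrite -scalemxAl mulmxA mxE pmulr_lgt0 //; exact: posdefmx_row.
Qed.

Lemma eigenvalue_posdef A a : posdefmx A -> eigenvalue A a -> 0 < a.
Proof.
by move=> A_gt0; rewrite -[A]mulmx1; apply: eigenvalue_posdef_mul posdefmx1.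
Qed.

End PositiveDefinite.

(** * Real functions of a Hermitian matrix *)

Section FunctionalCalculus.
Variables (R : realType) (n : nat).
Implicit Types (M : 'M[R[i]]_n) (f g : R -> R).

Definition speceig M j : R := complex.Re (spectral_diag M 0 j).

(** Built in the shape of [powRmx], so that real powers are instances by conversion. *)
Definition mxfun f M : 'M[R[i]]_n :=
  conj_diag (spectralmx M) (\row_j (f (speceig M j))%:C).

Lemma powRmxE M t : powRmx M t = mxfun (fun x => x `^ t) M.
Proof. by []. Qed.

Lemma eq_mxfun f g M :
  (forall j, f (speceig M j) = g (speceig M j)) -> mxfun f M = mxfun g M.
Proof.
by move=> eqfg; congr conj_diag; apply/rowP=> j; rewrite !mxE eqfg.
Qed.

Lemma mxfun_cst1 M : mxfun (fun=> 1) M = 1%:M.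
Proof.
rewrite -(conj_diag_const1 (spectral_unit M)); congr conj_diag.
by apply/rowP=> j; rewrite !mxE.
Qed.

Lemma mxfun_id M : M \is hermsymmx -> mxfun id M = M.
Proof.
move=> hM; have /hermitian_normalmx/orthomx_spectralP {2}-> := hM.
congr conj_diag; apply/rowP=> j; rewrite mxE RRe_real //.
exact: mxOverP (hermitian_spectral_diag_real hM) _ _.
Qed.

Lemma mxfunM f g M : mxfun f M *m mxfun g M = mxfun (fun x => f x * g x) M.
Proof.
rewrite /mxfun (conj_diagM _ _ (spectral_unit M)); congr conj_diag.
by apply/rowP=> j; rewrite !mxE rmorphM.
Qed.

Lemma mxfunD f g M : mxfun f M + mxfun g M = mxfun (fun x => f x + g x) M.
Proof.
rewrite /mxfun conj_diagD; congr conj_diag.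
by apply/rowP=> j; rewrite !mxE rmorphD.
Qed.

Lemma mxfunZ c f M : c%:C *: mxfun f M = mxfun (fun x => c * f x) M.
Proof.
rewrite /mxfun conj_diagZ; congr conj_diag.
by apply/rowP=> j; rewrite !mxE rmorphM.
Qed.

Lemma mxfun_adj f M : (mxfun f M)^t* = mxfun f M.
Proof.
rewrite /mxfun (conj_diag_adj _ (spectral_unitarymx M)); congr conj_diag.
by apply/rowP=> j; rewrite !mxE; apply: conjc_real.
Qed.

Lemma speceig_gt0 M j : posdefmx M -> 0 < speceig M j.
Proof.
move=> M_gt0; have [hM _] := M_gt0.
have := eigenvalue_conj_diag (\row_j (speceig M j)%:C) j (spectral_unit M).
rewrite -[conj_diag _ _]/(mxfun id M) mxfun_id // mxE.
by move/(eigenvalue_posdef M_gt0); rewrite ltcR.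
Qed.

(** With g the square root of f, f(M) = g(M)^* I g(M) is a congruence of the identity, and (1/g)(M)
    inverts g(M). *)
Lemma posdef_mxfun f M :
  (forall j, 0 < f (speceig M j)) -> posdefmx (mxfun f M).
Proof.
move=> f_gt0; pose g x := Num.sqrt (f x).
have g_gt0 j : 0 < g (speceig M j) by rewrite sqrtr_gt0.
have GV : mxfun g M *m mxfun (fun x => (g x)^-1) M = 1%:M.
  by rewrite mxfunM -(mxfun_cst1 M); apply: eq_mxfun => j; rewrite divff ?gt_eqF.
have -> : mxfun f M = (mxfun g M)^t* *m 1%:M *m mxfun g M.
  rewrite mxfun_adj mulmx1 mxfunM; apply: eq_mxfun => j.
  by rewrite -expr2 sqr_sqrtr // ltW.
exact: posdefmx_congr (@posdefmx1 R n) (mulmx1_unit GV).1.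
Qed.

Lemma possemidef_mxfun f M :
  possemidefmx (mxfun f M) <-> forall j, 0 <= f (speceig M j).
Proof.
split=> [[_ f_ge0] j|f_ge0].
  (* The test vector is the [j]-th eigenvector; only the [j]-th term of its quadratic form
     survives. *)
  have := f_ge0 (invmx (spectralmx M) *m delta_mx j 0).
  rewrite (conj_diag_form _ _ (spectral_unitarymx M)).
  rewrite (mulKVmx (spectral_unit M)) (bigD1 j) //= big1 => [|k kj].
    by rewrite !mxE !eqxx normr1 expr1n mulr1 addr0 lecR.
  by rewrite !mxE (negPf kj) normr0 expr0n mulr0.
split=> [|x]; first exact/hermsymmxP/mxfun_adj.
rewrite (conj_diag_form _ _ (spectral_unitarymx M)) sumr_ge0 // => j _.
by rewrite mxE mulr_ge0 ?lecR ?exprn_ge0.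
Qed.

End FunctionalCalculus.

(** Numerator minus denominator is (s - t)(x - 1). Applied to eigenvalues x of A^-1 # B, this
    compares two points of the Wasserstein curve. *)
Lemma affine_ratio_ge1 (R : realFieldType) (t s x : R) :
    t < s -> 0 < (1 - t) + t * x ->
  (1 <= ((1 - s) + s * x) / ((1 - t) + t * x)) = (1 <= x).
Proof.
move=> lt_ts yt0; rewrite ler_pdivlMr // mul1r -[LHS]subr_ge0 -[RHS]subr_ge0.
have -> : (1 - s) + s * x - ((1 - t) + t * x) = (s - t) * (x - 1) by ring.
by rewrite pmulr_rge0 ?subr_gt0.
Qed.

(** * Real powers, the geometric mean, and the near order along the two curves *)

Section Means.
Variables (R : realType) (n : nat).
Implicit Types (A B C D G K M X : 'M[R[i]]_n) (f : R -> R).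

Lemma loewner_le1_mxfun f M :
  loewner_le 1%:M (mxfun f M) <-> forall j, 1 <= f (speceig M j).
Proof.
rewrite /loewner_le; have -> : mxfun f M - 1%:M = mxfun (fun x => f x - 1) M.
  apply: (addIr 1%:M); rewrite subrK -(mxfun_cst1 M) mxfunD.
  by apply: eq_mxfun => j; rewrite subrK.
rewrite possemidef_mxfun.
by split=> le1 j; have := le1 j; rewrite subr_ge0.
Qed.

Lemma posdef_powRmx M t : posdefmx M -> posdefmx (powRmx M t).
Proof.
move=> M0; rewrite powRmxE; apply: posdef_mxfun => j.
exact/powR_gt0/speceig_gt0.
Qed.

Lemma powRmxD M s t : posdefmx M ->
  powRmx M s *m powRmx M t = powRmx M (s + t).
Proof.
move=> M0; rewrite !powRmxE mxfunM; apply: eq_mxfun => j.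
by rewrite powRD // (gt_eqF (speceig_gt0 j M0)) implybT.
Qed.

Lemma powRmx0 M : powRmx M 0 = 1%:M.
Proof.
by rewrite powRmxE -(mxfun_cst1 M); apply: eq_mxfun => j; rewrite powRr0.
Qed.

Lemma powRmx1 M : posdefmx M -> powRmx M 1 = M.
Proof.
move=> M0; have [hM _] := M0; rewrite powRmxE -[RHS](mxfun_id hM).
by apply: eq_mxfun => j; rewrite (powRr1 (ltW (speceig_gt0 j M0))).
Qed.

Lemma powRmx_sqrtK M : posdefmx M -> powRmx M 2^-1 *m powRmx M 2^-1 = M.
Proof. by move=> M0; rewrite powRmxD // -[X in X + X]mul1r -splitr powRmx1. Qed.

Lemma powRmxN M t : posdefmx M -> powRmx M t *m powRmx M (- t) = 1%:M.
Proof. by move=> M0; rewrite powRmxD // subrr powRmx0. Qed.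

Lemma powRmxNl M t : posdefmx M -> powRmx M (- t) *m powRmx M t = 1%:M.
Proof. by move=> M0; rewrite powRmxD // addNr powRmx0. Qed.

(** Both sides are square roots of [K *m K] with positive eigenvalues, and the left one is a
    [conj_diag] by definition, so [pos_sqrt_uniq] applies. *)
Lemma powRmx_sqr K : posdefmx K -> powRmx (K *m K) 2^-1 = K.
Proof.
move=> K0; have KK0 := posdefmx_sqr K0; apply/esym.
apply: pos_sqrt_uniq (spectral_unit _) _ _ _ => [j|a|].
- by rewrite mxE ltcR powR_gt0 // speceig_gt0.
- exact: eigenvalue_posdef.
- exact/esym/powRmx_sqrtK.
Qed.

(* With H = A^(1/2), A X = H (H X H) H^-1 is similar to a positive definite
   matrix. *)
Lemma posdef_mul_diagonalizable A X : posdefmx A -> posdefmx X ->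
  exists P (d : 'rV[R[i]]_n),
    [/\ P \in unitmx, forall j, 0 < d 0 j & A *m X = conj_diag P d].
Proof.
move=> A0 X0; pose H := powRmx A 2^-1; pose V := powRmx A (- 2^-1).
have H0 : posdefmx H := posdef_powRmx _ A0.
have HH : H *m H = A := powRmx_sqrtK A0.
have HV : H *m V = 1%:M := powRmxN 2^-1 A0.
have VH : V *m H = 1%:M := powRmxNl 2^-1 A0.
move: H V H0 HH HV VH => H V H0 HH HV VH.
have uV : V \in unitmx := (mulmx1_unit HV).2.
have N0 : posdefmx (H *m X *m H) := posdefmx_congr_pos X0 H0.
have [hN _] := N0.
have eqN := mxfun_id hN.
have d0 j := speceig_gt0 j N0.
have uU := spectral_unit (H *m X *m H).
move: eqN d0 uU; rewrite /mxfun.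
move: (speceig _) (spectralmx _) => d U eqN d0 uU.
exists (U *m V), (\row_j (d j)%:C); split=> [|j|].
- by rewrite unitmx_mul uU.
- by rewrite mxE ltcR.
have -> : A *m X = H *m (H *m X *m H) *m V.
  by rewrite -!mulmxA HV mulmx1 !mulmxA HH.
rewrite -eqN /conj_diag.
have -> : invmx (U *m V) = H *m invmx U.
  have uUV : U *m V \in unitmx by rewrite unitmx_mul uU.
  apply: (can_inj (mulKmx uUV)); rewrite (mulmxV uUV).
  by rewrite -mulmxA (mulmxA V) VH mul1mx (mulmxV uU).
by rewrite !mulmxA.
Qed.

(** [A *m X] has positive eigenvalues and is diagonalizable, so [pos_sqrt_uniq] makes it the only
    admissible root. *)
Lemma possqrtmx_sqr_mul A X : posdefmx A -> posdefmx X ->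
  possqrtmx ((A *m X) *m (A *m X)) = A *m X.
Proof.
move=> A0 X0; rewrite /possqrtmx; set E := [set S | _]%classic.
(* [A *m X] inhabits [E], so [xget] returns a genuine root and not the default 0. *)
have : E (xget 0 E).
  apply: (xgetPex 0); exists (A *m X); split=> // a.
  exact: eigenvalue_posdef_mul.
move: (xget 0 E) => S [eqS S0].
have [P [d [uP d0 eqAX]]] := posdef_mul_diagonalizable A0 X0.
by rewrite eqAX in eqS *; exact: pos_sqrt_uniq eqS.
Qed.

(** Uniqueness for the Riccati equation: with K = C^(1/2), K (G C G) K is the square of the positive
    definite K G K, and the outer factors H = K^-1 then cancel K. *)
Lemma gmeanmx_invl C G : posdefmx C -> posdefmx G ->
  gmeanmx (invmx C) (G *m C *m G) = G.
Proof.
move=> C0 G0; have V0 := posdefmx_inv C0; rewrite /gmeanmx.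
set H := powRmx _ 2^-1; set K := powRmx _ (- 2^-1).
have HK : H *m K = 1%:M := powRmxN 2^-1 V0.
have KH : K *m H = 1%:M := powRmxNl 2^-1 V0.
have HH : H *m H = invmx C := powRmx_sqrtK V0.
have K0 : posdefmx K := posdef_powRmx _ V0.
have uC := posdefmx_unit C0.
move: H K HK KH HH K0 => H K HK KH HH K0.
have KK : K *m K = C.
  have -> : K *m K = K *m K *m (H *m H) *m C.
    by rewrite HH (mulmxKV uC).
  by rewrite -!mulmxA (mulmxA K H) KH mul1mx (mulmxA K H) KH mul1mx.
have -> : K *m (G *m C *m G) *m K = (K *m G *m K) *m (K *m G *m K).
  by rewrite -KK !mulmxA.
rewrite powRmx_sqr; last exact: posdefmx_congr_pos G0 K0.
by rewrite !mulmxA HK mul1mx -mulmxA KH mulmx1.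
Qed.

Lemma posdef_gmeanmx A B : posdefmx A -> posdefmx B -> posdefmx (gmeanmx A B).
Proof.
move=> A0 B0; apply: posdefmx_congr_pos (posdef_powRmx _ A0).
apply: posdef_powRmx.
exact: posdefmx_congr_pos B0 (posdef_powRmx _ A0).
Qed.

(** Existence for the Riccati equation: X = H Q H with H = A^(-1/2), and H A H = I collapses X A X
    to H Q^2 H, where Q^2 = H^-1 B H^-1. *)
Lemma gmeanmx_riccati A B : posdefmx A -> posdefmx B ->
  let X := gmeanmx (invmx A) B in X *m A *m X = B.
Proof.
move=> A0 B0 X; have V0 := posdefmx_inv A0; rewrite /X /gmeanmx.
set H := powRmx (invmx A) 2^-1; set K := powRmx (invmx A) (- 2^-1).
have HK : H *m K = 1%:M := powRmxN 2^-1 V0.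
have KH : K *m H = 1%:M := powRmxNl 2^-1 V0.
have HH : H *m H = invmx A := powRmx_sqrtK V0.
have K0 : posdefmx K := posdef_powRmx _ V0.
have uA := posdefmx_unit A0.
move: H K HK KH HH K0 => H K HK KH HH K0.
have HAH : H *m A *m H = 1%:M.
  rewrite -[LHS]mul1mx -KH -!mulmxA (mulmxA H H) HH.
  by rewrite (mulKmx uA).
set Q := powRmx (K *m B *m K) 2^-1.
have QQ : Q *m Q = K *m B *m K.
  apply: powRmx_sqrtK; exact: posdefmx_congr_pos B0 K0.
have -> : H *m Q *m H *m A *m (H *m Q *m H)
        = H *m (Q *m (H *m A *m H) *m Q) *m H by rewrite !mulmxA.
by rewrite HAH mulmx1 QQ !mulmxA HK mul1mx -mulmxA KH mulmx1.
Qed.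

Lemma near_le_congr C D G : posdefmx C -> posdefmx G -> D = G *m C *m G ->
  near_le C D <-> loewner_le 1%:M G.
Proof.
move=> C0 G0 ->; split=> [[_ _]|G1]; first by rewrite (gmeanmx_invl C0 G0).
split; first exact: C0.
  exact: posdefmx_congr_pos C0 G0.
by rewrite (gmeanmx_invl C0 G0).
Qed.

Lemma near_le_speceig A B : posdefmx A -> posdefmx B ->
  near_le A B <-> forall j, 1 <= speceig (gmeanmx (invmx A) B) j.
Proof.
move=> A0 B0; set X := gmeanmx _ _.
have [hX _] : posdefmx X := posdef_gmeanmx (posdefmx_inv A0) B0.
have le1X : loewner_le 1%:M X <-> forall j, 1 <= speceig X j.
  by rewrite -{1}(mxfun_id hX) loewner_le1_mxfun.
split=> [[_ _ /le1X //]|X1]; split; [exact: A0|exact: B0|exact/le1X].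
Qed.

(** Congruence by G = X^(s-t) carries the point at [t] to the point at [s]; since s - t > 0, x^(s-t)
    >= 1 iff x >= 1. *)
Lemma near_le_spectral_mean A B t s : posdefmx A -> posdefmx B -> t < s ->
  near_le (spectral_mean t A B) (spectral_mean s A B) <-> near_le A B.
Proof.
move=> A0 B0 lt_ts; have X0 := posdef_gmeanmx (posdefmx_inv A0) B0.
rewrite (near_le_speceig A0 B0) /spectral_mean.
move: (gmeanmx _ _) X0 => X X0.
have G0 := posdef_powRmx (s - t) X0.
have Xt0 := posdef_powRmx t X0.
have XtG : powRmx X t *m powRmx X (s - t) = powRmx X s.
  by rewrite (powRmxD _ _ X0) addrC subrK.
have GXt : powRmx X (s - t) *m powRmx X t = powRmx X s.
  by rewrite (powRmxD _ _ X0) subrK.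
have eqG : powRmx X s *m A *m powRmx X s =
    powRmx X (s - t) *m (powRmx X t *m A *m powRmx X t) *m powRmx X (s - t).
  (* The two factors X^s are split in opposite orders, which puts G outermost on both sides. *)
  rewrite -{1}GXt -XtG.
  by move: (powRmx X t) (powRmx X (s - t)) => H G; rewrite !mulmxA.
rewrite (near_le_congr (posdefmx_congr_pos A0 Xt0) G0 eqG).
have st0 : 0 < s - t by rewrite subr_gt0.
rewrite powRmxE loewner_le1_mxfun; split=> X1 j; have := X1 j.
  apply: contraTT; rewrite -!ltNge => X1j.
  have := gt0_ltr_powR st0 _ _ X1j; rewrite powR1; apply.
    by rewrite nnegrE (ltW (speceig_gt0 j X0)).
  by rewrite nnegrE.
move=> X1j; have := ge0_ler_powR (ltW st0) _ _ X1j; rewrite powR1; apply.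
  by rewrite nnegrE.
by rewrite nnegrE (ltW (speceig_gt0 j X0)).
Qed.

(** Since B = X A X, the two square roots are A X and X A, exactly the cross terms of the expanded
    product Y A Y. *)
Lemma wasserstein_meanE t A B : posdefmx A -> posdefmx B ->
  let Y := mxfun (fun x => (1 - t) + t * x) (gmeanmx (invmx A) B) in
  wasserstein_mean t A B = Y *m A *m Y.
Proof.
move=> A0 B0 Y; have X0 := posdef_gmeanmx (posdefmx_inv A0) B0.
have XAX := gmeanmx_riccati A0 B0.
move: (gmeanmx _ _) X0 XAX @Y => X X0 XAX Y.
have -> : Y = (1 - t)%:C *: 1%:M + t%:C *: X.
  have [hX _] := X0.
  rewrite -[X in _ + t%:C *: X](mxfun_id hX) -(mxfun_cst1 X) !mxfunZ mxfunD.
  by apply: eq_mxfun => j; rewrite mulr1.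
rewrite /wasserstein_mean.
have -> : A *m B = (A *m X) *m (A *m X) by rewrite -XAX !mulmxA.
have -> : B *m A = (X *m A) *m (X *m A) by rewrite -XAX !mulmxA.
rewrite (possqrtmx_sqr_mul A0 X0) (possqrtmx_sqr_mul X0 A0) -XAX.
rewrite !(mulmxDl, mulmxDr) -!(scalemxAl, scalemxAr) !mul1mx !mulmx1.
rewrite !scalerA !rmorphXn !rmorphM /= scalerDr !expr2.
rewrite (mulrC (1 - t)%:C t%:C).
move: (_ *: A) (_ *: (A *m X)) (_ *: (X *m A)) (_ *: (X *m A *m X)) => a p r q.
rewrite -!addrA; congr (_ + _); rewrite addrCA [RHS]addrCA; congr (_ + _).
exact: addrC.
Qed.

(** The positivity hypotheses make Y_t, Y_s and their ratio G positive definite. They can fail for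
    parameters outside [0, 1], for instance above 1 when X has a small eigenvalue. *)
Lemma near_le_wasserstein_mean A B t s : posdefmx A -> posdefmx B -> t < s ->
    (forall j, 0 < (1 - t) + t * speceig (gmeanmx (invmx A) B) j) ->
    (forall j, 0 < (1 - s) + s * speceig (gmeanmx (invmx A) B) j) ->
  near_le (wasserstein_mean t A B) (wasserstein_mean s A B) <-> near_le A B.
Proof.
move=> A0 B0 lt_ts.
rewrite (wasserstein_meanE _ A0 B0) (wasserstein_meanE _ A0 B0).
rewrite (near_le_speceig A0 B0).
move: (gmeanmx _ _) => X t0 s0.
pose y u x : R := (1 - u) + u * x.
pose G := mxfun (fun x => y s x / y t x) X.
have GYt : G *m mxfun (y t) X = mxfun (y s) X.
  by rewrite mxfunM; apply: eq_mxfun => j; rewrite divfK // gt_eqF ?t0.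
have YtG : mxfun (y t) X *m G = mxfun (y s) X.
  by rewrite mxfunM; apply: eq_mxfun => j; rewrite mulrC divfK // gt_eqF ?t0.
have G0 : posdefmx G by apply: posdef_mxfun => j; rewrite divr_gt0 ?t0 ?s0.
have Yt0 : posdefmx (mxfun (y t) X) := posdef_mxfun t0.
have eqG : mxfun (y s) X *m A *m mxfun (y s) X =
    G *m (mxfun (y t) X *m A *m mxfun (y t) X) *m G.
  rewrite -{1}GYt -YtG.
  by move: (mxfun (y t) X) G {GYt YtG G0 Yt0} => Y G; rewrite !mulmxA.
rewrite (near_le_congr (posdefmx_congr_pos A0 Yt0) G0 eqG).
rewrite loewner_le1_mxfun.
by split=> X1 j; have := X1 j; rewrite (affine_ratio_ge1 lt_ts (t0 j)).
Qed.

End Means.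

Theorem theorem3p6 (R : realType) (n : nat) (A B : 'M[R[i]]_n)
    (hA : posdefmx A) (hB : posdefmx B) :
  [<-> near_le A B;
       exists t s : R, [/\ 0 <= t, t < s, s <= 1 &
         near_le (wasserstein_mean t A B) (wasserstein_mean s A B)];
       exists t s : R, t < s /\
         near_le (spectral_mean t A B) (spectral_mean s A B)]
  /\
  (near_le A B ->
     (forall t s : R, 0 <= t -> t < s ->
        near_le (wasserstein_mean t A B) (wasserstein_mean s A B)) /\
     (forall t s : R, t < s ->
        near_le (spectral_mean t A B) (spectral_mean s A B))).
Proof.
have X0 j : 0 < speceig (gmeanmx (invmx A) B) j.
  exact/speceig_gt0/posdef_gmeanmx/hB/posdefmx_inv/hA.
(* A convex combination of 1 and a positive eigenvalue, whether or not A is below B. *)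
have y0 t j : 0 <= t <= 1 -> 0 < (1 - t) + t * speceig (gmeanmx (invmx A) B) j.
  by move=> /andP[t0 t1]; have := X0 j; nra.
have ltE t s : t < s ->
    near_le (spectral_mean t A B) (spectral_mean s A B) <-> near_le A B.
  exact: near_le_spectral_mean.
have wmono (t s : R) : near_le A B -> 0 <= t -> t < s ->
    near_le (wasserstein_mean t A B) (wasserstein_mean s A B).
  (* Parameters beyond 1 are allowed here: [AB] gives eigenvalues x >= 1, so 1 + t (x - 1) >= 1 for
     every t >= 0. *)
  move=> AB t0 lt_ts; apply/near_le_wasserstein_mean => // j.
    have := (near_le_speceig hA hB).1 AB j; nra.
  have := (near_le_speceig hA hB).1 AB j; nra.
split; last first.
  by move=> AB; split=> t s => [|/ltE ->//]; exact: wmono.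
tfae.
- move=> AB; exists 0, 1; split; [exact: lexx|exact: ltr01|exact: lexx|].
  exact: wmono AB (lexx 0) ltr01.
(* The same pair serves again: for fixed [t < s] in [0, 1], either comparison is equivalent to
   [near_le A B]. *)
- move=> [t [s [t0 lt_ts s1 ABts]]]; exists t, s; split; first exact: lt_ts.
  apply/(ltE _ _ lt_ts).
  apply: (near_le_wasserstein_mean hA hB lt_ts _ _).1 ABts => j; apply: y0.
    by rewrite t0 (le_trans (ltW lt_ts) s1).
  by rewrite s1 (le_trans t0 (ltW lt_ts)).
- by move=> [t [s [lt_ts /(ltE _ _ lt_ts)]]].
Qed.
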